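(* Let $G$ be a fixed edge-ordered graph with minimal edge $e_0$. If $e_0$ is isolated in $G$, then $ssat_m(n,G)=O(1)$; otherwise $ssat_m(n,G)=\Omega(n)$.
   Context: An edge-ordered graph is a finite simple graph together with a linear order on its edge set (usually given by an injective labeling $l:E\to\mathbb{N}$ or $l:E\to\mathbb{R}$). A copy of $G$ in an edge-ordered graph $H$ is a subgraph of $H$ (with the induced edge-order) isomorphic to $G$ by an isomorphism respecting the edge-order. The minimal edge $e_0$ of $G$ is the edge with the smallest label; an edge is isolated if it shares no vertex with any other edge. $ssat_m(n,G)$ is the minimum number of edges in an edge-ordered graph $H$ on $n$ vertices (not required to be $G$-free) such that adding to $H$ any missing edge, inserted at the beginning of the linear order (i.e. with a label smaller than all labels of $H$), creates a new copy of $G$ (one using the added edge). Asymptotic notation is for $n\to\infty$ with $G$ fixed ($n$ is assumed large enough). *)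

(* Defs.v *)
From mathcomp Require Import all_boot.
From mathcomp Require Import boolp.

Set Implicit Arguments.
Unset Strict Implicit.
Unset Printing Implicit Defensive.

(* Only the relative order of the labels of edges is meaningful; the values of
   [label] outside [edges] are junk, and nothing below depends on them. *)
Record eograph (V : finType) := EOGraph {
  edges : {set {set V}};
  label : {set V} -> nat;
  edges_card2 : forall e, e \in edges -> #|e| = 2;
  label_inj : {in edges &, injective label}
}.

Definition min_edge (V : finType) (G : eograph V) (e0 : {set V}) : Prop :=
  e0 \in edges G /\
  forall f, f \in edges G -> f != e0 -> label G e0 < label G f.

Definition isolated_edge (V : finType) (G : eograph V) (e : {set V}) : Prop :=
  e \in edges G /\
  forall f, f \in edges G -> f != e -> [disjoint e & f].

(* The subgraph of [H] with vertex set [S] and edge set [F], ordered as in [H],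
   is a copy of [G]. It is not required to be induced; that the edges in [F]
   have their ends in [S] follows from the equations for [S] and [F]. *)
Definition is_copy (V W : finType) (G : eograph V) (H : eograph W)
    (S : {set W}) (F : {set {set W}}) : Prop :=
  F \subset edges H /\
  exists phi : V -> W,
    [/\ injective phi,
        phi @: [set: V] = S,
        [set phi @: e | e : {set V} in edges G] = F
      & {in edges G &, forall e f,
           (label G e < label G f) = (label H (phi @: e) < label H (phi @: f))}].

Section AddMin.
Variables (W : finType) (H : eograph W) (e : {set W}).
Hypothesis e2 : #|e| = 2.

(* The labels of [H] are shifted by one, which keeps their order and leaves 0
   for the new edge. *)
Definition add_min_label (f : {set W}) : nat :=
  if f == e then 0 else (label H f).+1.

Lemma add_min_card2 f : f \in e |: edges H -> #|f| = 2.
Proof. by case/setU1P => [->//|]; exact: edges_card2. Qed.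

Lemma add_min_label_inj : {in e |: edges H &, injective add_min_label}.
Proof.
move=> f g; rewrite !in_setU1 /add_min_label.
case: (eqVneq f e) => [->|_]; case: (eqVneq g e) => [->|_] //= fH gH [].
exact: label_inj.
Qed.

Definition add_min : eograph W := EOGraph add_min_card2 add_min_label_inj.

End AddMin.

Definition semisat_min (V W : finType) (G : eograph V) (H : eograph W) : Prop :=
  forall (e : {set W}) (e2 : #|e| = 2), e \notin edges H ->
    exists S F, is_copy G (add_min H e2) S F /\ e \in F.

Definition semisat_min_size (V : finType) (G : eograph V) (n m : nat) : bool :=
  `[< exists H : eograph 'I_n, semisat_min G H /\ #|edges H| = m >].

(* The complete graph is vacuously semisaturated, so the minimum exists. *)
Lemma semisat_min_size_ex (V : finType) (G : eograph V) (n : nat) :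
  exists m, semisat_min_size G n m.
Proof.
have c2 (e : {set 'I_n}) : e \in [set f : {set 'I_n} | #|f| == 2] -> #|e| = 2.
  by rewrite inE => /eqP.
have li : {in [set f : {set 'I_n} | #|f| == 2] &,
    injective (fun f : {set 'I_n} => nat_of_ord (enum_rank f))}.
  by move=> f g _ _ /val_inj /enum_rank_inj.
exists #|edges (EOGraph c2 li)|; apply/asboolP; exists (EOGraph c2 li).
by split=> // e e2; rewrite inE e2.
Qed.

Definition ssat_m (n : nat) (V : finType) (G : eograph V) : nat :=
  ex_minn (semisat_min_size_ex G n).

(* Main.v *)
Require Import Defs.
From mathcomp Require Import all_boot all_order all_algebra.
From mathcomp Require Import all_classical all_reals all_analysis.
From mathcomp Require Import zify.
Import numFieldNormedType.Exports.

(** If [e0] is isolated, three disjoint copies of [G - e0], padded with isolated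
    vertices, are semisaturated: a new edge meets at most two of the copies, and
    together with an untouched one it forms a copy of [G].
    If [e0] is not isolated, some edge of [G] meets it, so one end of every
    missing edge of [H] is covered by [H]; hence [H] has at most one isolated
    vertex and at least (n - 1)/2 edges. *)

Set Implicit Arguments.
Unset Strict Implicit.
Unset Printing Implicit Defensive.

(** * The minimum defining [ssat_m] *)

Lemma ssat_m_le (V : finType) (G : eograph V) n (H : eograph 'I_n) :
  semisat_min G H -> ssat_m n G <= #|edges H|.
Proof.
move=> sH; rewrite /ssat_m; case: ex_minnP => m _; apply.
by apply/asboolP; exists H.
Qed.

Lemma ssat_mP (V : finType) (G : eograph V) n :
  exists H : eograph 'I_n, semisat_min G H /\ #|edges H| = ssat_m n G.
Proof. by rewrite /ssat_m; case: ex_minnP => m /asboolP. Qed.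

(** * Upper bound: disjoint copies of [G] without [e0] *)

Section DisjointCopies.
Variables (V W : finType) (G : eograph V) (e0 : {set V}).
Hypotheses (he0 : min_edge G e0) (iso_e0 : isolated_edge G e0).
Variables (k : nat) (iota : 'I_k * V -> W).
Hypothesis iota_inj : injective iota.

Definition copy_edge (p : 'I_k * {set V}) : {set W} :=
  [set iota (p.1, v) | v in p.2].

Definition copy_index : {set 'I_k * {set V}} :=
  finset.setX [set: 'I_k]%SET (edges G :\ e0)%SET.

Lemma copy_indexE i f : ((i, f) \in copy_index) = (f != e0) && (f \in edges G).
Proof. by rewrite finset.in_setX finset.in_setT finset.in_setD1. Qed.

Lemma copy_edge_card p : #|copy_edge p| = #|p.2|.
Proof. by rewrite card_imset // => u v /iota_inj []. Qed.

(** An edge is nonempty, and any vertex of its image reveals the index of the copy. *)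
Lemma copy_edge_inj : {in copy_index &, injective copy_edge}.
Proof.
move=> [i f] [j g]; rewrite !copy_indexE => /andP[_ fG] /andP[_ gG] efg.
have /card_gt0P[v vf] : 0 < #|f| by rewrite (edges_card2 fG).
have : iota (i, v) \in copy_edge (j, g) by rewrite -efg imset_f.
case/imsetP => w _ /iota_inj [ij _]; rewrite -ij in efg *.
by congr pair; apply: imset_inj efg => x y /iota_inj [].
Qed.

(* Multiplying by [k] makes room for the index of the copy, so labels of
   different copies never collide. *)
Definition copy_label (h : {set W}) : nat :=
  if [pick p in copy_index | copy_edge p == h] is Some p
  then label G p.2 * k + p.1 else 0.

Lemma copy_labelE i f : (i, f) \in copy_index ->
  copy_label (copy_edge (i, f)) = label G f * k + i.
Proof.
move=> fI; rewrite /copy_label; case: pickP => [p /andP[pI /eqP]|/(_ (i, f))].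
  by move/(copy_edge_inj pI fI) => ->.
by rewrite fI eqxx.
Qed.

Lemma copies_card2 h : h \in copy_edge @: copy_index -> #|h| = 2.
Proof.
case/imsetP=> -[i f]; rewrite copy_indexE => /andP[_ fG] ->.
by rewrite copy_edge_card (edges_card2 fG).
Qed.

Lemma copies_label_inj : {in copy_edge @: copy_index &, injective copy_label}.
Proof.
move=> _ _ /imsetP[[i f] fI ->] /imsetP[[j g] gI ->].
rewrite !copy_labelE // => eq_lab.
have k0 : 0 < k by apply: leq_ltn_trans (ltn_ord i).
(* Reducing modulo [k] recovers the index of the copy; the labels in [G] are compared afterwards. *)
have ij : i = j.
  apply/val_inj; rewrite /= -(modn_small (ltn_ord i)) -(modn_small (ltn_ord j)).
  by rewrite -(modnMDl (label G f)) eq_lab modnMDl.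
move: eq_lab fI gI; rewrite ij !copy_indexE => /addIn /eqP.
rewrite eqn_pmul2r // => /eqP lfg /andP[_ fG] /andP[_ gG].
by rewrite (label_inj fG gG lfg).
Qed.

Definition copies : eograph W := EOGraph copies_card2 copies_label_inj.

Lemma card_edges_copies : #|edges copies| <= k * #|edges G|.
Proof.
apply: leq_trans (leq_imset_card _ _) _.
rewrite finset.cardsX cardsT card_ord leq_mul2l subset_leq_card ?orbT //.
exact: finset.subD1set.
Qed.

(** Pigeonhole: if [e] met every copy, choosing a common vertex for each would inject ['I_k] into
    [e]. *)
Lemma free_copy (e : {set W}) : #|e| < k ->
  exists i, forall v, iota (i, v) \notin e.
Proof.
move=> ek; apply: contrapT => nofree.
have hit i : exists v, iota (i, v) \in e.
  apply: contrapT => nv; apply: nofree; exists i => v.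
  by apply/negP => ve; apply: nv; exists v.
have [w we] := choice hit.
have: #|[set iota (i, w i) | i : 'I_k]| <= #|e|.
  by apply: subset_leq_card; apply/fintype.subsetP => _ /imsetP[i _ ->].
by rewrite leqNgt card_imset ?card_ord ?ek // => i j /iota_inj [].
Qed.

Lemma semisat_copies : 2 < k -> semisat_min G copies.
Proof.
move=> k2 e e2 eH.
have [i ifree] : exists i, forall v, iota (i, v) \notin e.
  by apply: free_copy; rewrite e2.
have [e0G e0min] := he0; have [_ e0iso] := iso_e0.
have /cards2P[a [b [ab e0E]]] : #|e0| == 2 by rewrite (edges_card2 e0G).
have /cards2P[c [d [cd eE]]] : #|e| == 2 by rewrite e2.
have ce : c \in e by rewrite eE !inE eqxx.
have de : d \in e by rewrite eE !inE eqxx orbT.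
(* The ends of [e0] go to the ends of the new edge, all other vertices into copy [i], which avoids
   [e]. *)
pose phi v := if v == a then c else if v == b then d else iota (i, v).
have phi_inj : injective phi.
  move=> u v; rewrite /phi.
  have iN w x : x \in e -> iota (i, w) <> x.
    by move=> xe E; have := ifree w; rewrite E xe.
  have [ua|_] := eqVneq u a; have [va|_] := eqVneq v a.
  - by rewrite ua va.
  - have [_ E|_ /esym/(iN _ _ ce)//] := eqVneq v b.
    by move: cd; rewrite E eqxx.
  - have [_ E|_ /(iN _ _ ce)//] := eqVneq u b.
    by move: cd; rewrite E eqxx.
  - have [ub|_] := eqVneq u b; have [vb|_] := eqVneq v b.
    + by rewrite ub vb.
    + by move=> /esym/(iN _ _ de).
    + by move=> /(iN _ _ de).
    + by move=> /iota_inj [].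
have phi_e0 : phi @: e0 = e.
  by rewrite e0E eE imsetU1 imset_set1 /phi eqxx eq_sym (negbTE ab) eqxx.
(* Isolation of [e0] enters here: [f] avoids [a] and [b], so [phi] agrees on it with the embedding
   of copy [i]. *)
have phiE f : f \in edges G -> f != e0 -> phi @: f = copy_edge (i, f).
  move=> fG fe0; apply: eq_in_imset => v vf; rewrite /phi.
  have dis x : x \in e0 -> (v == x) = false.
    move=> xe0; apply/eqP => vx.
    by have := disjointFr (e0iso f fG fe0) xe0; rewrite -vx vf.
  by rewrite !dis // e0E !inE eqxx ?orbT.
have phiH f : f \in edges G -> f != e0 -> phi @: f \in edges copies.
  by move=> fG fe0; rewrite phiE //= imset_f // copy_indexE fe0 fG.
have phi_ne f : f \in edges G -> f != e0 -> phi @: f != e.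
  by move=> fG fe0; apply: contra eH => /eqP <-; apply: phiH.
exists (phi @: [set: V]%SET), [set phi @: f | f : {set V} in edges G].
split; last by rewrite -phi_e0; apply: imset_f.
split.
  apply/fintype.subsetP => _ /imsetP[f fG ->]; rewrite finset.in_setU1.
  by case: (eqVneq f e0) => [->|/(phiH f fG) ->]; rewrite ?phi_e0 ?eqxx ?orbT.
exists phi; split => // f g fG gG; rewrite /= /add_min_label.
have [->|fe0] := eqVneq f e0; have [->|ge0] := eqVneq g e0.
- by rewrite phi_e0 !eqxx !ltnn.
- by rewrite phi_e0 eqxx (negbTE (phi_ne _ gG ge0)) e0min.
- by rewrite phi_e0 eqxx ltn0 ltnNge ltnW // e0min.
(* Both edges lie in the same copy, where the label is the increasing map sending [l] to
   [l * k + i]. *)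
- rewrite (negbTE (phi_ne _ fG fe0)) (negbTE (phi_ne _ gG ge0)) ltnS !phiE //.
  rewrite /= !copy_labelE ?copy_indexE ?fe0 ?ge0 // ltn_add2r ltn_pmul2r //.
  exact: ltn_trans k2.
Qed.

End DisjointCopies.

Lemma ssat_m_isolated (V : finType) (G : eograph V) e0 n :
  min_edge G e0 -> isolated_edge G e0 -> 3 * #|V| <= n ->
  ssat_m n G <= 3 * #|edges G|.
Proof.
move=> he0 iso_e0 Vn.
have card_n : #|{: 'I_3 * V}| <= n by rewrite card_prod card_ord.
(* The copies fill an initial segment of ['I_n]; the later vertices are the padding. *)
pose iota (p : 'I_3 * V) : 'I_n := widen_ord card_n (enum_rank p).
have iota_inj : injective iota.
  by move=> p q [] /val_inj /enum_rank_inj.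
apply: leq_trans (card_edges_copies G e0 iota_inj).
exact/ssat_m_le/semisat_copies.
Qed.

(** * Lower bound: covered vertices *)

Lemma not_isolated_edge (V : finType) (G : eograph V) e :
  e \in edges G -> ~ isolated_edge G e ->
  exists f v, [/\ f \in edges G, f != e, v \in e & v \in f].
Proof.
move=> eG niso; apply: contrapT => nf; apply: niso; split=> // f fG fe.
rewrite disjoint_subset; apply/fintype.subsetP => v ve.
by rewrite inE; apply/negP => vf; apply: nf; exists f, v.
Qed.

(* In a copy using the new edge, this edge has the least label, so it plays the
   role of [e0]. *)
Lemma semisat_touch (V W : finType) (G : eograph V) (H : eograph W) e0
    (e : {set W}) :
  min_edge G e0 -> ~ isolated_edge G e0 -> semisat_min G H ->
  #|e| = 2 -> e \notin edges H -> exists x, x \in e /\ x \in finset.cover (edges H).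
Proof.
move=> [e0G e0min] niso sH e2 eH.
have [S [F [[Fsub [phi [phi_inj _ FE ord_phi]]] eF]]] := sH e e2 eH.
have phi_e0 : phi @: e0 = e.
  move: eF; rewrite -FE => /imsetP[g gG eg].
  have [<-//|ge0] := eqVneq g e0.
  have := ord_phi _ _ e0G gG; rewrite (e0min _ gG ge0) -eg.
  by rewrite /= {2}/add_min_label eqxx ltn0.
have [f [v [fG fe0 ve0 vf]]] := not_isolated_edge e0G niso.
exists (phi v); split; first by rewrite -phi_e0 imset_f.
apply/finset.bigcupP; exists (phi @: f); last exact: imset_f.
(* Since [f] differs from [e0] and [phi] is injective, the image of [f] is not the new edge, so it
   belongs to [H]. *)
have : phi @: f \in edges (add_min H e2).
  by apply: (fintype.subsetP Fsub); rewrite -FE imset_f.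
rewrite finset.in_setU1 -phi_e0 => /predU1P[/(imset_inj phi_inj) E|//].
by rewrite E eqxx in fe0.
Qed.

Lemma card_cover_edges (W : finType) (H : eograph W) :
  #|finset.cover (edges H)| <= 2 * #|edges H|.
Proof.
apply: leq_trans (finset.leq_card_cover _) _.
by rewrite (eq_bigr (fun=> 2)) => [|e /edges_card2//]; rewrite sum_nat_const mulnC.
Qed.

Lemma semisat_card (V W : finType) (G : eograph V) (H : eograph W) e0 :
  min_edge G e0 -> ~ isolated_edge G e0 -> semisat_min G H ->
  #|W| <= (2 * #|edges H|).+1.
Proof.
move=> he0 niso sH; rewrite -(cardsC (finset.cover (edges H))) -addn1.
apply: leq_add (card_cover_edges H) _.
(* Two uncovered vertices would span a missing edge with no covered end. *)
rewrite leqNgt; apply/negP => /card_gt1P[x [y [xC yC xy]]].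
move: xC yC; rewrite !finset.in_setC => xC yC.
have e2 : #|[set x; y]%SET| = 2 by rewrite cards2 xy.
have eH : [set x; y]%SET \notin edges H.
  apply: contra xC => eH; apply/finset.bigcupP; exists [set x; y]%SET => //.
  exact: finset.set21.
have [z []] := semisat_touch he0 niso sH e2 eH.
by rewrite finset.in_set2 => /orP[] /eqP ->; apply/negP.
Qed.

Lemma ssat_m_not_isolated (V : finType) (G : eograph V) e0 n :
  min_edge G e0 -> ~ isolated_edge G e0 -> n <= (2 * ssat_m n G).+1.
Proof.
move=> he0 niso; have [H [sH <-]] := ssat_mP G n.
by have := semisat_card he0 niso sH; rewrite card_ord.
Qed.

(** * Asymptotic form of the bounds *)

Import Order.TTheory GRing.Theory Num.Theory.
Local Open Scope classical_set_scope.
Local Open Scope ring_scope.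

Theorem claim6 (R : realType) (V : finType) (G : eograph V) (e0 : {set V})
    (he0 : min_edge G e0) :
  (isolated_edge G e0 ->
     (fun n : nat => (ssat_m n G)%:R : R^o) =O_\oo (fun _ : nat => 1 : R^o)) /\
  (~ isolated_edge G e0 ->
     (fun n : nat => (ssat_m n G)%:R : R^o) =Omega_\oo (fun n : nat => n%:R : R^o)).
Proof.
split=> [iso_e0|niso].
  (* The successor makes the constant visibly positive. *)
  apply/eqO_exP; exists (3 * #|edges G|).+1%:R; first by rewrite ltr0n.
  near=> n; rewrite normr1 mulr1 normr_nat ler_nat.
  apply: leqW; apply: ssat_m_isolated he0 iso_e0 _.
  by near: n; exact: nbhs_infty_ge.
(* With [m] the value of [ssat_m], [n <= 2 * m + 1] and [2 <= n] force [1 <= m], hence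
   [n <= 4 * m]. *)
rewrite eqOmegaE eqOmegaO; apply/eqO_exP; exists 4%:R; first by rewrite ltr0n.
near=> n; rewrite !normr_nat -natrM ler_nat.
have n2 : (2 <= n)%N by near: n; exact: nbhs_infty_ge.
have := ssat_m_not_isolated n he0 niso; lia.
Unshelve. all: by end_near. Qed.
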